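(* Let $G$ be a chordal graph and $t\ge 2$ an integer. Then the edge ideal $I(\overline{\mathcal{CH}_t(G)})$ has a $t$-linear resolution over any field $\mathbb{K}$.
   Context: All graphs are finite and simple, with $V(G)=\{x_1,\dots,x_n\}$ identified with variables of $R=\mathbb{K}[x_1,\dots,x_n]$. A graph is chordal if every induced cycle has length $3$. $\mathcal{CH}_t(G)$ is the $t$-uniform clutter on $V(G)$ whose edges are the $t$-element subsets inducing complete subgraphs. Its complement $\overline{\mathcal{CH}_t(G)}$ is the clutter whose edges are all $t$-element subsets of $V(G)$ that are not $t$-cliques of $G$. The edge ideal of a clutter $\mathcal{C}$ is $I(\mathcal{C})=(\prod_{x_i\in e}x_i : e\in E(\mathcal{C}))$. A homogeneous ideal $I$ has a $t$-linear resolution if all minimal generators have degree $t$ and $\beta_{i,i+j}(I)=0$ for all $i$ and all $j\ne t$. *)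

(* Defs.v *)
From HB Require Import structures.
From mathcomp Require Import all_boot all_order all_algebra.
From mathcomp Require Import mpoly.
Set Implicit Arguments. Unset Strict Implicit. Unset Printing Implicit Defensive.
Import GRing.Theory.
Local Open Scope ring_scope.

Definition simple_graph (n : nat) (e : rel 'I_n) : Prop :=
  irreflexive e /\ ssrbool.symmetric e.

Definition cyc_adj (m i j : nat) : bool :=
  [|| j == i.+1, i == j.+1, (i == 0%N) && (j == m.-1) | (j == 0%N) && (i == m.-1)].

Definition induced_long_cycle (n : nat) (e : rel 'I_n) (s : seq 'I_n) : Prop :=
  [/\ uniq s, (4 <= size s)%N &
      forall x y, x \in s -> y \in s -> x != y ->
        e x y = cyc_adj (size s) (index x s) (index y s)].

Definition chordal (n : nat) (e : rel 'I_n) : Prop :=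
  forall s : seq 'I_n, ~ induced_long_cycle e s.

Definition is_clique (n : nat) (e : rel 'I_n) (S : {set 'I_n}) : bool :=
  [forall x in S, forall y in S, (x != y) ==> e x y].

Definition compl_CH_edge (n t : nat) (e : rel 'I_n) (S : {set 'I_n}) : bool :=
  (#|S| == t) && ~~ is_clique e S.

Definition xS (K : fieldType) (n : nat) (S : {set 'I_n}) : {mpoly K[n]} :=
  \prod_(i in S) 'X_i.

Definition in_edge_ideal (K : fieldType) (n : nat) (E : pred {set 'I_n})
    (p : {mpoly K[n]}) : Prop :=
  exists c : {set 'I_n} -> {mpoly K[n]}, p = \sum_(S | E S) c S * xS K S.

(* I (an ideal given by its membership predicate) has a t-linear resolution:
   there is a graded free resolution
     ... -> F_2 --d 1--> F_1 --d 0--> F_0 --g--> I -> 0,  F_i = R(-t-i)^(b i),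
   of finite length (b i = 0 for i > k), i.e. g has entries homogeneous of
   degree t, all the d i have entries homogeneous of degree 1 (linear forms),
   and the complex is exact.  Such a resolution is (up to isomorphism) the
   minimal one, so this is equivalent to beta_{i,i+j}(I) = 0 for j <> t. *)
Definition has_linear_resolution (K : fieldType) (n t : nat)
    (I : {mpoly K[n]} -> Prop) : Prop :=
  exists (b : nat -> nat) (k : nat)
         (g : 'rV[{mpoly K[n]}]_(b 0%N))
         (d : forall i : nat, 'M[{mpoly K[n]}]_(b i, b i.+1)),
  [/\ (forall i, (k < i)%N -> b i = 0%N),
      (forall j, g 0 j \is t.-homog) /\ (forall i r c, d i r c \is 1%N.-homog),
      (forall p, I p <-> exists v : 'cV_(b 0%N), p = (g *m v) 0 0),
      (forall v : 'cV_(b 0%N), g *m v = 0 <-> exists w, v = d 0%N *m w) &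
      (forall i (v : 'cV_(b i.+1)), d i *m v = 0 <-> exists w, v = d i.+1 *m w)].

(* Main.v *)
Require Import Defs.
From mathcomp Require Import all_boot all_order all_algebra.
From mathcomp Require Import mpoly zify ring.
Set Implicit Arguments. Unset Strict Implicit. Unset Printing Implicit Defensive.
Import GRing.Theory.

(* Let v be a simplicial vertex of the induced subgraph on W.  A set S containing
   v is a non-clique iff S - v is not contained in the neighbourhood N(v), so the
   ideal of the t-subsets of W that are not cliques is x_v J + I, where J is
   generated by the (t-1)-subsets of W - v not contained in N(v) and I is the
   ideal of the same kind for W - v.  Since I is contained in J and x_v is a
   nonzerodivisor modulo I, the kernel of x_v J (+) I -> x_v J + I is x_v I, and a
   mapping cone turns linear resolutions of J and I into one of x_v J + I.
   The ideals J are handled by the same splitting, with any vertex outside N(v)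
   in place of v.

   A simplicial vertex is found off any vertex v that is not universal: let C be
   a connected component of the non-neighbours of v and S the set of vertices
   outside C adjacent to C.  By chordality S is a clique, and induction applies
   to C + S, which does not contain v. *)

(** * Shortest paths have no chords *)

Lemma connect_shortest_path (T : finType) (r : rel T) (x y : T) :
  connect r x y ->
  exists p, [/\ path r x p, last x p = y, uniq (x :: p) &
    forall i j, i < j <= size p ->
      r (nth x (x :: p) i) (nth x (x :: p) j) -> j = i.+1].
Proof.
case/connectP=> p0 p0P lp0.
have ex0 : exists m, [exists q : m.-tuple T, path r x q && (last x q == y)].
  exists (size p0); apply/existsP; exists (in_tuple p0).
  by rewrite /= p0P lp0 eqxx.
case: (ex_minnP ex0) => m /existsP[q /andP[qP /eqP lq]] minm.
have min p : path r x p -> last x p = y -> m <= size p.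
  move=> pP lp; apply: minm; apply/existsP; exists (in_tuple p).
  by rewrite /= pP lp eqxx.
exists q.
(* [drop j q] is what follows vertex [j] of [x :: q]. If it can also be followed from an earlier
   vertex [i], splicing gives a walk shorter than [q]. This is used for a repeated vertex, and at
   [j.-1] for a chord from [i] to [j]. *)
have cut i j : i < j <= size q -> path r (nth x (x :: q) i) (drop j q) ->
    last (nth x (x :: q) i) (drop j q) = y -> False.
  move=> /andP[ij jq] dP dl.
  have lt : last x (take i q) = nth x (x :: q) i.
    case: i {dP dl} ij => [|i] ij /=; first by rewrite take0.
    by rewrite (take_nth x) ?last_rcons //; lia.
  have : m <= size (take i q ++ drop j q).
    apply: min; rewrite ?cat_path ?last_cat lt // dP andbT.
    by move: qP; rewrite -{1}(cat_take_drop i q) cat_path => /andP[].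
  rewrite size_cat size_drop size_takel; last by lia.
  by move: ij jq; rewrite size_tuple; lia.
have dropP j : j <= size q -> path r (nth x (x :: q) j) (drop j q)
     /\ last (nth x (x :: q) j) (drop j q) = y.
  move=> jq.
  have lt : last x (take j q) = nth x (x :: q) j.
    case: j jq => [|j] ij /=; first by rewrite take0.
    by rewrite (take_nth x) ?last_rcons.
  move: qP lq; rewrite -{1 2}(cat_take_drop j q) cat_path last_cat lt.
  by move=> /andP[].
split=> //.
  apply/(uniqP x) => i j; rewrite !inE /= => iq jq eqij.
  wlog ij : i j iq jq eqij / i < j.
    by move=> h; case: (ltngtP i j) => // hij; [apply: h | apply/esym/h].
  have [|dP dl] := dropP j; first by lia.
  by case: (cut i j); rewrite ?eqij //; lia.
move=> i j /andP[ij jq] rij; apply/eqP; case: (eqVneq j i.+1) => // nij.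
have [dP dl] := dropP j jq.
have jp : j.-1 < size q by lia.
have nj : nth x q j.-1 = nth x (x :: q) j by case: (j) ij.
case: (cut i j.-1); first by lia.
  rewrite (drop_nth x) //= nj rij /=; have -> : j.-1.+1 = j by lia.
  exact: dP.
by rewrite (drop_nth x) //= nj; have -> : j.-1.+1 = j by lia.
Qed.

(** * Simplicial vertices of chordal graphs *)

Section Simplicial.
Variables (n : nat) (e : rel 'I_n).
Hypotheses (e_simple : simple_graph e) (e_chordal : chordal e).

Let e_irr x : e x x = false. Proof. by case: e_simple. Qed.
Let e_sym x y : e x y = e y x. Proof. by case: e_simple => _ ->. Qed.

Lemma nth_induced_long_cycle (x0 : 'I_n) (s : seq 'I_n) :
    uniq s -> 4 <= size s ->
    (forall i j, i < j < size s -> e (nth x0 s i) (nth x0 s j) =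
       (j == i.+1) || (i == 0) && (j == (size s).-1)) ->
  induced_long_cycle e s.
Proof.
move=> us s4 es; split=> // x y xs ys xy.
have := xs; have := ys; rewrite -!index_mem => iy ix.
have nxy : index x s != index y s.
  by apply: contraNneq xy => h; rewrite -(nth_index x0 xs) h nth_index.
rewrite -{1}(nth_index x0 xs) -{1}(nth_index x0 ys) /cyc_adj.
move: (index x s) (index y s) nxy ix iy => i j nij ix iy.
case: (ltngtP i j) => [ij|ij|ij].
- by rewrite es ?ij //; lia.
- by rewrite e_sym es ?ij //; lia.
- by rewrite ij eqxx in nij.
Qed.

(* The cycle through [v], [x], a shortest path inside [C], and [y] is induced. *)
Lemma chordal_neighbours_adjacent (C : {set 'I_n}) (v x y : 'I_n) :
    v \notin C -> (forall z, z \in C -> ~~ e v z) ->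
    e v x -> e v y -> x != y ->
    connect [rel a b | [&& e a b, a \in y |: (x |: C) & b \in y |: (x |: C)]] x y ->
  e x y.
Proof.
set r := [rel a b | _] => vC vCe vx vy xy.
case/connect_shortest_path=> p [pP lp up short].
apply/negPn/negP => nxy.
have vnx : v != x by apply: contraTneq vx => ->; rewrite e_irr.
have vny : v != y by apply: contraTneq vy => ->; rewrite e_irr.
have mem z : z \in x :: p -> z \in y |: (x |: C).
  rewrite inE => /orP[/eqP->|]; first by rewrite !inE eqxx orbT.
  move: pP; rewrite /r; move: (y |: _) => D; elim: (p) (x) => //= a q IHq b /andP[/and3P[_ _ aD] qP].
  by rewrite inE => /orP[/eqP->|] //; apply: IHq qP.
(* As [x] and [y] are distinct and supposed non-adjacent, the path has an interior vertex, so the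
   cycle [v :: x :: p] has length at least 4. *)
have sp2 : 2 <= size p.
  case: p pP lp {up short mem} => [|a [|b p]] //=.
    by move=> _ h; rewrite h eqxx in xy.
  by move=> /andP[/and3P[h _ _] _] h'; rewrite h' (negPf nxy) in h.
have nthlast : nth x (x :: p) (size p) = y by rewrite -lp (last_nth x).
apply: (e_chordal (s := v :: x :: p)).
apply: (@nth_induced_long_cycle x) => //=; try lia.
  rewrite -[_ && uniq _]/(uniq (x :: p)) up andbT.
  by apply: contra (mem v) _; rewrite !inE negb_or vny negb_or vnx.
move=> [|i] [|j] //; rewrite ltnS => /andP[ij js]; rewrite /= !eqSS.
  rewrite /= in js.
  case: j ij js => [|j] ij js; first by rewrite vx.
  case: (eqVneq j.+1 (size p)) => [->|jnp].
    by rewrite nthlast vy orbT.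
  rewrite /=.
  have : nth x (x :: p) j.+1 \in x :: p by apply: mem_nth; rewrite /=; lia.
  move/mem; rewrite !inE => /or3P[/eqP h|/eqP h|].
  - suff: j.+1 = size p by lia.
    apply/eqP; rewrite -(nth_uniq x _ _ up) /=; try lia.
    by rewrite -[nth x p j]/(nth x (x :: p) j.+1) h -nthlast /=.
  - suff: j.+1 = 0 by lia.
    by apply/eqP; rewrite -(nth_uniq x _ _ up) ?h /=; try lia.
  - by move/vCe/negPf->; lia.
have jp : j <= size p := js.
rewrite orbF; apply/idP/eqP => [eij|->].
  apply: short; first by rewrite ij.
  by rewrite /r /= eij !mem // mem_nth //= ltnS // ltnW // (leq_trans ij).
by have /and3P[] := pathP x pP i (leq_trans ij jp).
Qed.

Definition simplicial (W : {set 'I_n}) (v : 'I_n) : Prop :=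
  v \in W /\ forall x y, x \in W -> y \in W -> e v x -> e v y -> x != y -> e x y.

(** A strengthening of Dirac's theorem that makes the induction work: used inside [C :|: S] at some
    [s] of the clique [S], it gives a vertex not adjacent to [s], which therefore lies in [C]. *)
Lemma chordal_simplicial_off (W : {set 'I_n}) (v u : 'I_n) :
    v \in W -> u \in W -> u != v -> ~~ e v u ->
  exists w, [/\ simplicial W w, w != v & ~~ e v w].
Proof.
have [k] := ubnP #|W|; elim: k W v u => // k IHk W v u; rewrite ltnS => Wk vW uW uv evu.
pose D := [set z in W | (z != v) && ~~ e v z].
pose rD := [rel a b | [&& e a b, a \in D & b \in D]].
pose C := [set z | connect rD u z].
have uD : u \in D by rewrite inE uW uv.
have sym_rD : connect_sym rD.
  by apply: sym_connect_sym => a b /=; rewrite e_sym [(a \in D) && _]andbC.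
have CD : {subset C <= D}.
  move=> z; rewrite inE => /connectP[p + ->].
  elim/last_ind: p => [//|p a _]; rewrite rcons_path last_rcons.
  by case/andP=> _ /and3P[].
have CE z : z \in C -> [/\ z \in W, z != v & ~~ e v z].
  by move/CD; rewrite inE => /and3P[].
have Cext a b : a \in C -> b \in D -> e a b -> b \in C.
  move=> aC bD ab; move: (aC); rewrite !inE => /connect_trans; apply.
  by apply: connect1; rewrite /= ab bD CD.
pose S := [set z in W | e v z && [exists c in C, e c z]].
have SE z : z \in S -> [/\ z \in W, e v z & exists2 c, c \in C & e c z].
  by rewrite inE => /and3P[-> -> /exists_inP].
(* All neighbours in [W] of a vertex of [C] lie in [C :|: S]; hence a vertex of [C] that is
   simplicial there is simplicial in [W], which is [lift] below. *)
have nbrC c z : c \in C -> z \in W -> e c z -> (z \in C) || (z \in S).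
  move=> cC zW cz; have [_ cv evc] := CE c cC.
  have zv : z != v by apply: contraNneq evc => <-; rewrite e_sym.
  case ez: (e v z); last by rewrite (Cext c) // inE zW zv ez.
  by rewrite orbC inE zW ez; apply/orP; left; apply/exists_inP; exists c.
have vnC : v \notin C by apply/negP => /CE[_]; rewrite eqxx.
have S_clique x y : x \in S -> y \in S -> x != y -> e x y.
  case/SE=> xW vx [c cC cx] /SE[yW vy [d dC dy]] xy.
  apply: (@chordal_neighbours_adjacent C v) => //; first by move=> z /CE[].
  have inU z : z \in C -> z \in y |: (x |: C) by rewrite !inE => ->; rewrite !orbT.
  apply: (@connect_trans _ _ c).
    by apply: connect1; rewrite /= e_sym cx (inU c) // !inE eqxx orbT.
  apply: (@connect_trans _ _ d); last first.
    by apply: connect1; rewrite /= dy (inU d) // !inE eqxx.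
  have /connectP[p pP ->] : connect rD c d.
    rewrite !inE in cC dC; apply: connect_trans dC.
    by rewrite sym_rD.
  elim: p c cC {cx} pP => [|b p IHp] c cC /=; first by rewrite connect0.
  case/andP=> /and3P[cb cD bD] pP.
  have bC : b \in C by apply: Cext cb.
  apply: connect_trans (IHp b bC pP).
  by apply: connect1; rewrite /= cb !inU.
pose U := C :|: S.
have UW : #|U| < k.
  apply: leq_trans Wk; apply: proper_card; apply/properP; split.
    by apply/subsetP => z /setUP[/CE[]|/SE[]].
  by exists v => //; rewrite inE negb_or vnC inE e_irr andbF.
have uC : u \in C by rewrite inE connect0.
have CW : #|C| < k by apply: leq_ltn_trans UW; apply/subset_leq_card/subsetUl.
have lift w : w \in C -> simplicial U w -> exists w, [/\ simplicial W w, w != v & ~~ e v w].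
  move=> wC [wU wS]; have [wW wv evw] := CE w wC.
  exists w; split=> //; split=> // x y xW yW wx wy xy.
  by apply: wS => //; rewrite inE (nbrC w).
(* Three cases: [U] is complete and [u] itself works; some vertex of [S] has a non-neighbour in [U];
   or every vertex of [S] is adjacent to the rest of [U], so that non-adjacent pairs of [U] lie in
   [C]. *)
have [/existsP[s /existsP[z /and4P[sU zU zs esz]]]|Uclique] :=
    boolP [exists s, exists z, [&& s \in U, z \in U, z != s & ~~ e s z]]; last first.
  apply: (lift u uC); split=> [|x y xU yU ux uy xy]; first by rewrite inE uC.
  move: Uclique; rewrite negb_exists => /forallP/(_ x).
  rewrite negb_exists => /forallP/(_ y).
  by rewrite xU yU eq_sym xy /= negbK.
have [/existsP[{}s /existsP[{}z /and4P[{}sU {}zU {}zs {}esz]]]|Suniv] :=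
    boolP [exists s, exists z, [&& s \in S, z \in U, z != s & ~~ e s z]].
  have sU' : s \in U by rewrite inE sU orbT.
  have [w [wsimp ws esw]] := IHk U s z UW sU' zU zs esz.
  apply: (lift w) => //; case: (wsimp) => /setUP[//|wS] _.
  by rewrite S_clique // eq_sym in esw.
have univ x y : x \in S -> y \in U -> y != x -> e x y.
  move=> xS yU yx; move: Suniv; rewrite negb_exists => /forallP/(_ x).
  rewrite negb_exists => /forallP/(_ y).
  by rewrite xS yU yx /= negbK.
have inC x y : x \in U -> y \in U -> x != y -> ~~ e x y -> x \in C.
  move=> /setUP[//|xS] yU xy; rewrite univ //; by rewrite eq_sym.
have sC : s \in C by apply: (inC s z) => //; rewrite eq_sym.
have zC : z \in C by apply: (inC z s) => //; rewrite e_sym.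
(* Here induction runs on [C] alone: adding the vertices of [S], adjacent to everything in [U],
   keeps [w] simplicial. *)
have [w [[wC wS] _ _]] := IHk C s z CW sC zC zs esz.
apply: (lift w wC); split=> [|x y xU yU wx wy xy]; first by rewrite inE wC.
case/setUP: (xU) => [xC|xS]; last by apply: univ => //; rewrite eq_sym.
case/setUP: (yU) => [yC|yS]; last by rewrite e_sym; apply: univ.
exact: wS.
Qed.

Lemma chordal_simplicial (W : {set 'I_n}) (v : 'I_n) :
  v \in W -> exists w, simplicial W w.
Proof.
move=> vW.
have [/existsP[s /existsP[z /and4P[sW zW zs esz]]]|Wclique] :=
    boolP [exists s, exists z, [&& s \in W, z \in W, z != s & ~~ e s z]].
  by have [w [ws _ _]] := chordal_simplicial_off sW zW zs esz; exists w.
exists v; split=> // x y xW yW _ _ xy.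
move: Wclique; rewrite negb_exists => /forallP/(_ x).
rewrite negb_exists => /forallP/(_ y).
by rewrite xW yW eq_sym xy /= negbK.
Qed.
End Simplicial.

(** * Homogeneous components and a choice principle *)

Local Open Scope ring_scope.

Lemma pihomogM (n : nat) (K : comNzRingType) (s d : nat) (p q : {mpoly K[n]}) :
  p \is s.-homog -> pihomog mdeg (s + d) (p * q) = p * pihomog mdeg d q.
Proof.
move=> p_homog.
(* The bound is raised to [d.+1] so that [d] indexes a summand even when it exceeds the degree of
   [q]. *)
have := @pihomog_partitionE _ _ mdeg (maxn d.+1 (mmeasure mdeg q)) q (leq_maxr _ _).
set k := maxn _ _ => {1}->.
rewrite mulr_sumr raddf_sum /=.
have dk : (d < k)%N by rewrite leq_max leqnn.
rewrite (bigD1 (Ordinal dk)) //= big1 ?addr0 => [|i id].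
  by rewrite pihomog_dE // dhomogM // pihomogP.
apply: (@pihomog_ne0 _ _ _ (s + i)); last by rewrite dhomogM // pihomogP.
by rewrite eqn_add2l.
Qed.

(** Since [R] is boolean and each [X i] is a choice type, [xchoose] selects successors without any
    axiom; the invariant [P] travels in a sigma type. *)
Lemma dependent_choice (X : nat -> choiceType) (x0 : X 0%N)
    (P : forall i, X i -> Prop) (R : forall i, X i -> pred (X i.+1)) :
    P 0%N x0 -> (forall i x, P i x -> exists y, R i x y) ->
    (forall i x y, P i x -> R i x y -> P i.+1 y) ->
  exists f : forall i, X i, f 0%N = x0 /\ forall i, R i (f i) (f i.+1).
Proof.
move=> P0 stepR stepP.
pose next i (x : {x : X i | P i x}) : {y : X i.+1 | P i.+1 y} :=
  let ex := stepR i (sval x) (svalP x) in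
  exist _ (xchoose ex) (stepP i _ _ (svalP x) (xchooseP ex)).
pose f := fix f i : {x : X i | P i x} :=
  if i is j.+1 then next j (f j) else exist _ x0 P0.
by exists (fun i => sval (f i)); split=> // i; apply: (xchooseP (stepR _ _ _)).
Qed.

(** * Linear resolutions as matrices, comparison maps and the mapping cone *)

Section LinearResolutions.
Variables (K : fieldType) (n : nat).
Notation R := {mpoly K[n]}.

Definition homog_mx (d : nat) (a b : nat) (A : 'M[R]_(a, b)) : bool :=
  [forall i, forall j, A i j \is d.-homog].

Lemma homog_mxP (d a b : nat) (A : 'M[R]_(a, b)) :
  reflect (forall i j, A i j \is d.-homog) (homog_mx d A).
Proof.
apply: (iffP forallP) => [h i j|h i]; first by have /forallP := h i; exact.
by apply/forallP => j; apply: h.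
Qed.

Lemma homog_mxM (s d a b c : nat) (A : 'M[R]_(a, b)) (B : 'M[R]_(b, c)) :
  homog_mx s A -> homog_mx d B -> homog_mx (s + d) (A *m B).
Proof.
move=> /homog_mxP hA /homog_mxP hB; apply/homog_mxP => i j; rewrite mxE.
by apply: rpred_sum => k _; rewrite dhomogM.
Qed.

(** A preimage [w] of a homogeneous column need not be homogeneous, but [A] is, so the degree [d]
    component of [w] is a preimage too. *)
Lemma homog_mx_lift (s d a b c : nat) (A : 'M[R]_(a, b)) (B : 'M[R]_(a, c)) :
    homog_mx s A -> homog_mx (s + d) B ->
    (forall j, exists w, col j B = A *m w) ->
  exists2 W : 'M[R]_(b, c), B = A *m W & homog_mx d W.
Proof.
move=> /homog_mxP hA /homog_mxP hB /fin_all_exists[w wP].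
exists (\matrix_(i, j) pihomog mdeg d (w j i 0)); last first.
  by apply/homog_mxP => i j; rewrite mxE pihomogP.
apply/matrixP => i j; rewrite -[LHS](@pihomog_dE _ _ mdeg (s + d)) //.
have -> : B i j = col j B i 0 by rewrite mxE.
rewrite wP !mxE raddf_sum; apply: eq_bigr => k _ /=.
by rewrite mxE pihomogM.
Qed.

Lemma has_linear_resolution_iff (t : nat) (I J : R -> Prop) :
  (forall p, I p <-> J p) -> has_linear_resolution t I -> has_linear_resolution t J.
Proof.
move=> IJ [b [k [g [d [b0 hom Ig gd dd]]]]]; exists b, k, g, d; split=> // p.
by rewrite -IJ.
Qed.

Lemma has_linear_resolution0 (t : nat) :
  has_linear_resolution t (fun p : R => p = 0).
Proof.
exists (fun=> 0%N), 0%N, 0, (fun _ => 0); split=> //.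
- by split=> [[]|? []].
- move=> p; split=> [->|[v ->]]; last by rewrite mul0mx mxE.
  by exists 0; rewrite mul0mx mxE.
- move=> v; rewrite mul0mx; split=> // _.
  by exists 0; apply/matrixP => -[].
- move=> i v; rewrite mul0mx; split=> // _.
  by exists 0; apply/matrixP => -[].
Qed.

Lemma has_linear_resolution1 : has_linear_resolution 0 (fun p : R => True).
Proof.
exists (fun i => (i == 0)%N : nat), 0%N, 1%:M, (fun _ => 0); split=> //.
- by case.
- by split=> [j|? ? []//]; rewrite mxE ord1 dhomog1.
- move=> p; split=> // _; exists p%:M; by rewrite mul1mx mxE eqxx mulr1n.
- move=> v; rewrite mul1mx; split=> [->|[w ->]]; last by rewrite mul0mx.
  by exists 0; rewrite mul0mx.
- move=> i v; rewrite mul0mx; split=> // _.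
  by exists 0; apply/matrixP => -[].
Qed.


Lemma homog_mx0 (s a b : nat) : homog_mx s (0 : 'M[R]_(a, b)).
Proof. by apply/homog_mxP => i j; rewrite mxE dhomog0. Qed.

Lemma homog_mxN (s a b : nat) (A : 'M[R]_(a, b)) : homog_mx s A -> homog_mx s (- A).
Proof. by move/homog_mxP => h; apply/homog_mxP => i j; rewrite mxE dhomogN. Qed.

Lemma homog_row_mx (s a b c : nat) (A : 'M[R]_(a, b)) (B : 'M[R]_(a, c)) :
  homog_mx s A -> homog_mx s B -> homog_mx s (row_mx A B).
Proof.
by move=> /homog_mxP hA /homog_mxP hB; apply/homog_mxP => i j; rewrite mxE; case: split.
Qed.

Lemma homog_col_mx (s a b c : nat) (A : 'M[R]_(a, c)) (B : 'M[R]_(b, c)) :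
  homog_mx s A -> homog_mx s B -> homog_mx s (col_mx A B).
Proof.
by move=> /homog_mxP hA /homog_mxP hB; apply/homog_mxP => i j; rewrite mxE; case: split.
Qed.

Lemma homog_block_mx (s a b c d : nat) (A : 'M[R]_(a, c)) (B : 'M[R]_(a, d))
    (C : 'M[R]_(b, c)) (D : 'M[R]_(b, d)) :
  homog_mx s A -> homog_mx s B -> homog_mx s C -> homog_mx s D ->
  homog_mx s (block_mx A B C D).
Proof. by move=> *; apply: homog_col_mx; apply: homog_row_mx. Qed.

Lemma homog_mx_scalarX (i : 'I_n) (a : nat) : homog_mx 1 (('X_i : R)%:M : 'M[R]_a).
Proof.
apply/homog_mxP => r c; rewrite mxE.
case: (r == c); rewrite ?mulr1n ?mulr0n ?dhomog0 // dhomogX.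
by apply/eqP/mdeg1.
Qed.

Lemma mulmx_eq0P (a b c : nat) (A : 'M[R]_(a, b)) (B : 'M[R]_(b, c)) :
  (forall w : 'cV_c, A *m (B *m w) = 0) -> A *m B = 0.
Proof.
move=> AB0; apply/matrixP => i j.
have /matrixP/(_ i 0) := AB0 (delta_mx j 0).
by rewrite mulmxA -colE !mxE.
Qed.

(** The comparison theorem for an inclusion of ideals. The generators differ by one degree and all
    differentials are linear, so homogeneous lifting makes every [phi i] linear, as the mapping cone
    requires. *)
Lemma linear_resolution_chain_map (s : nat) (b b' : nat -> nat)
    (g : 'rV[R]_(b 0%N)) (d : forall i, 'M[R]_(b i, b i.+1))
    (g' : 'rV[R]_(b' 0%N)) (d' : forall i, 'M[R]_(b' i, b' i.+1)) :
    homog_mx s g -> (forall i, homog_mx 1 (d i)) ->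
    homog_mx s.+1 g' -> (forall i, homog_mx 1 (d' i)) ->
    (forall v : 'cV_(b 0%N), g *m v = 0 -> exists w, v = d 0%N *m w) ->
    (forall i (v : 'cV_(b i.+1)), d i *m v = 0 -> exists w, v = d i.+1 *m w) ->
    g' *m d' 0%N = 0 -> (forall i, d' i *m d' i.+1 = 0) ->
    (forall j, exists w, col j g' = g *m w) ->
  exists phi : forall i, 'M[R]_(b i, b' i),
    [/\ forall i, homog_mx 1 (phi i), g' = g *m phi 0%N &
        forall i, phi i *m d' i = d i *m phi i.+1].
Proof.
move=> hg hd hg' hd' exg exd gd' dd' lift0.
have [|phi0 g'E hphi0] := homog_mx_lift (d := 1) hg _ lift0; first by rewrite addn1.
(* The invariant says that the next lifting problem is solvable; exactness of [d] propagates it. *)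
pose P i (A : 'M[R]_(b i, b' i)) :=
  homog_mx 1 A /\ forall j, exists w, col j (A *m d' i) = d i *m w.
pose S i (A : 'M[R]_(b i, b' i)) : pred 'M[R]_(b i.+1, b' i.+1) :=
  fun B => homog_mx 1 B && (A *m d' i == d i *m B).
have [|i A [hA liftA]|i A B [hA liftA] /andP[hB /eqP AB]|phi [phi0E phiS]] :=
    dependent_choice (X := fun i => 'M[R]_(b i, b' i)) (x0 := phi0) (P := P) (R := S).
- split=> // j; apply: exg.
  by rewrite colE !mulmxA -g'E gd' mul0mx.
- have hAd : homog_mx (1 + 1) (A *m d' i) by apply: homog_mxM.
  have [B AB hB] := homog_mx_lift (hd i) hAd liftA.
  by exists B; rewrite /S hB AB eqxx.
- split=> // j; apply: exd.
  by rewrite colE !mulmxA -AB -(mulmxA A) dd' mulmx0 mul0mx.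
exists phi; split=> [[|i]||i]; rewrite ?phi0E //.
- by case/andP: (phiS i).
- by case/andP: (phiS i) => _ /eqP.
Qed.


(* The mapping cone [F_i + G_i + G_(i-1)] of the map [G(-1) -> F(-1) + G],
   [w |-> (phi w, - x w)], where [F] and [G] resolve [J] and [I]. *)
Lemma linear_resolution_betti_splitting (t : nat) (x : 'I_n) (I J : R -> Prop) :
    has_linear_resolution t J -> has_linear_resolution t.+1 I ->
    (forall p, I p -> J p) -> (forall p, I ('X_x * p) -> I p) ->
  has_linear_resolution t.+1 (fun p => exists q r, [/\ J q, I r & p = 'X_x * q + r]).
Proof.
move=> [b [k [g [d [b0 [hg hd] Jg gd dd]]]]].
move=> [b' [k' [g' [d' [b'0 [hg' hd'] Ig' gd' dd']]]]] IJ xI.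
have {}hg : homog_mx t g by apply/homog_mxP => i j; rewrite ord1.
have {}hg' : homog_mx t.+1 g' by apply/homog_mxP => i j; rewrite ord1.
have {}hd i : homog_mx 1 (d i) by apply/homog_mxP.
have {}hd' i : homog_mx 1 (d' i) by apply/homog_mxP.
have Jg_mx (A : 'cV_1) : J (A 0 0) <-> exists v, A = g *m v.
  rewrite Jg; split=> -[v Av]; exists v; last by rewrite Av.
  by apply/matrixP => i j; rewrite !ord1.
have Ig_mx (A : 'cV_1) : I (A 0 0) <-> exists v, A = g' *m v.
  rewrite Ig'; split=> -[v Av]; exists v; last by rewrite Av.
  by apply/matrixP => i j; rewrite !ord1.
have gd0 : g *m d 0%N = 0 by apply: mulmx_eq0P => w; apply/gd; exists w.
have gd0' : g' *m d' 0%N = 0 by apply: mulmx_eq0P => w; apply/gd'; exists w.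
have dd0 i : d i *m d i.+1 = 0 by apply: mulmx_eq0P => w; apply/dd; exists w.
have dd0' i : d' i *m d' i.+1 = 0 by apply: mulmx_eq0P => w; apply/dd'; exists w.
have [v /gd //|i v /dd //|//|//|j|phi [hphi g'E phid]] :=
    linear_resolution_chain_map hg hd hg' hd'.
  by apply/Jg_mx/IJ/Ig_mx; exists (delta_mx j 0); rewrite colE.
pose X : R := 'X_x.
have X_neq0 : X != 0 by rewrite -msize_poly_eq0 msizeX.
have XI a b1 (A : 'M[R]_(a, b1)) : X%:M *m A = 0 -> A = 0.
  rewrite mul_scalar_mx => XA; apply/matrixP => i j.
  have /matrixP/(_ i j) := XA; rewrite !mxE => /eqP.
  by rewrite mulf_eq0 (negPf X_neq0) => /eqP.
(* The summand [b' j] is the shifted copy of the resolution of [I]; it is absent at index 0. The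
   shift also accounts for the extra successor in the length bound below. *)
pose c i := if i is j.+1 then (b i + (b' i + b' j))%N else (b i + b' i)%N.
pose gC : 'rV[R]_(c 0%N) := row_mx (X *: g) g'.
pose dC i : 'M[R]_(c i, c i.+1) :=
  if i is j.+1 then
    block_mx (d j.+1) (row_mx 0 (phi j.+1)) 0 (block_mx (d' j.+1) (- X%:M) 0 (- d' j))
  else block_mx (d 0%N) (row_mx 0 (phi 0%N)) 0 (row_mx (d' 0%N) (- X%:M)).
have dC0E u v w : dC 0%N *m col_mx u (col_mx v w) =
    col_mx (d 0%N *m u + phi 0%N *m w) (d' 0%N *m v - X *: w).
  rewrite /= mul_block_col !mul_row_col !mul0mx !add0r.
  by rewrite mulNmx mul_scalar_mx.
have dCSE j u v w : dC j.+1 *m col_mx u (col_mx v w) =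
    col_mx (d j.+1 *m u + phi j.+1 *m w) (col_mx (d' j.+1 *m v - X *: w) (- (d' j *m w))).
  rewrite /= mul_block_col mul_block_col !mul_row_col !mul0mx !add0r.
  by rewrite !mulNmx mul_scalar_mx.
have gCE u v : gC *m col_mx u v = X *: (g *m u) + g' *m v.
  by rewrite mul_row_col -scalemxAl.
exists c, (maxn k k').+1, gC, dC; split.
- move=> [|i] //; rewrite ltnS gtn_max => /andP[ki k'i] /=.
  by rewrite b0 ?b'0 //; apply: ltnW.
- split=> [j|i r s].
    have /homog_mxP : homog_mx t.+1 gC; last exact.
    apply: homog_row_mx => //; rewrite -mul_scalar_mx -add1n.
    by apply: homog_mxM => //; apply: homog_mx_scalarX.
  have /homog_mxP : homog_mx 1 (dC i); last exact.
  case: i {r s} => [|i] /=.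
    by rewrite homog_block_mx ?homog_row_mx ?homog_mx0 ?homog_mxN ?homog_mx_scalarX.
  by rewrite !homog_block_mx ?homog_row_mx ?homog_mx0 ?homog_mxN ?homog_mx_scalarX.
- move=> p; split=> [[q [r [/Jg[u ->] /Ig'[v ->] ->]]]|[v ->]].
    by exists (col_mx u v); rewrite gCE !mxE.
  rewrite -[v]vsubmxK gCE; exists ((g *m usubmx v) 0 0), ((g' *m dsubmx v) 0 0).
  by split; [apply/Jg; eexists | apply/Ig'; eexists | rewrite !mxE].
- move=> v; split=> [|[w ->]]; last first.
    rewrite -[w]vsubmxK -[dsubmx w]vsubmxK dC0E gCE mulmxDr mulmxBr !mulmxA gd0 gd0'.
    by rewrite !mul0mx !add0r -g'E -scalemxAr subrr.
  rewrite -[v]vsubmxK gCE; move: (usubmx v) (dsubmx v) => u {}v guv.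
  (* From [guv], [X] times [g *m u] lies in [I], hence so does [g *m u]. Its preimage [w] under [g']
     is the shifted component, and correcting [u] and [v] by it leaves kernel elements of [g] and
     [g']. *)
  have /Ig_mx[w guw] : I ((g *m u) 0 0).
    apply: xI; rewrite -/X; have -> : X * (g *m u) 0 0 = (g' *m - v) 0 0.
      by move/matrixP/(_ 0 0)/eqP: guv; rewrite mulmxN !mxE addr_eq0 => /eqP.
    by apply/Ig_mx; eexists.
  have /gd[u' u'E] : g *m (u - phi 0%N *m w) = 0.
    by rewrite mulmxBr mulmxA -g'E guw subrr.
  have /gd'[v' v'E] : g' *m (v + X *: w) = 0.
    by rewrite mulmxDr -scalemxAr -guw addrC.
  exists (col_mx u' (col_mx v' w)).
  by rewrite dC0E -u'E -v'E subrK addrK.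
(* Once the shifted component is a boundary [d' i *m w'], taking [- w'] there reduces exactness of
   the cone to exactness of the two given resolutions. *)
have exact_cone i (u : 'cV_(b i.+1)) (v : 'cV_(b' i.+1)) (w' : 'cV_(b' i.+1)) :
    d i *m u + phi i *m (d' i *m w') = 0 -> d' i *m v - X *: (d' i *m w') = 0 ->
    exists z, col_mx u (col_mx v (d' i *m w')) = dC i.+1 *m z.
  rewrite mulmxA phid -mulmxA -mulmxDr => /dd[u' u'E].
  rewrite scalemxAr -mulmxBr => /dd'[v' v'E].
  exists (col_mx u' (col_mx v' (- w'))); rewrite dCSE -u'E -v'E.
  by rewrite scalerN opprK subrK !mulmxN opprK addrK.
case=> [|i] v; (split=> [|[w ->]]; last first).
- rewrite -[w]vsubmxK -[dsubmx w]vsubmxK dCSE dC0E.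
  rewrite !mulmxDr !mulmxN !mulmxA dd0 dd0' !mul0mx !add0r phid.
  by rewrite subrr scalerN opprK -scalemxAr addNr !col_mx0.
- rewrite -[v]vsubmxK; move: (usubmx v) (dsubmx v) => u {}v.
  rewrite -[v]vsubmxK dC0E; move: (usubmx v) (dsubmx v) => {}v w /eqP.
  rewrite !col_mx_eq0 => /andP[/eqP duw /eqP dvw].
  (* In the lowest degree no component of the cone states this: it follows from [d' 0 *m v = X *: w]
     by applying [g'] and cancelling [X]. *)
  have /gd'[w' w'E] : g' *m w = 0.
    apply: XI; rewrite mul_scalar_mx scalemxAr.
    by move/eqP: dvw; rewrite subr_eq0 => /eqP <-; rewrite mulmxA gd0' mul0mx.
  by rewrite w'E; apply: exact_cone; rewrite -w'E.
- rewrite -[w]vsubmxK -[dsubmx w]vsubmxK !dCSE.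
  rewrite !mulmxDr !mulmxN !mulmxA dd0 !dd0' !mul0mx !add0r phid.
  by rewrite subrr !scalerN opprK -scalemxAr addNr !oppr0 !col_mx0.
- rewrite -[v]vsubmxK; move: (usubmx v) (dsubmx v) => u {}v.
  rewrite -[v]vsubmxK dCSE; move: (usubmx v) (dsubmx v) => {}v w /eqP.
  rewrite !col_mx_eq0 oppr_eq0 => /and3P[/eqP duw /eqP dvw /eqP/dd'[w' w'E]].
  by rewrite w'E; apply: exact_cone; rewrite -w'E.
Qed.

End LinearResolutions.

(** * Edge ideals and their splitting at a vertex *)

Lemma subset_setD1 (T : finType) (a : T) (A B : {set T}) :
  a \in A -> a \in B -> (A :\ a \subset B :\ a) = (A \subset B).
Proof.
move=> aA aB; rewrite subsetD1 setD11 andbT -{2}(setD1K aA).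
by rewrite subUset sub1set aB.
Qed.

Section EdgeIdeals.
Variables (K : fieldType) (n : nat).
Notation R := {mpoly K[n]}.

(** Setting the variable of [v] to 0; being fixed by this map expresses that the variable does not
    occur. *)
Definition subst0 (v : 'I_n) (p : R) : R :=
  p \mPo [tuple (if i == v then 0 else 'X_i) | i < n].

Lemma subst0X (v i : 'I_n) : subst0 v 'X_i = if i == v then 0 else 'X_i.
Proof. by rewrite /subst0 comp_mpolyXU -tnth_nth tnth_mktuple. Qed.

Lemma subst0M (v : 'I_n) : {morph subst0 v : p q / p * q}.
Proof. by move=> p q; rewrite /subst0 rmorphM. Qed.

Lemma subst0_decomp (v : 'I_n) (p : R) :
  exists r q, p = r + 'X_v * q /\ subst0 v r = r.
Proof.
pose D p := exists r q, p = r + 'X_v * q /\ subst0 v r = r.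
have DM p1 p2 : D p1 -> D p2 -> D (p1 * p2).
  case=> r1 [q1 [-> r1E]] [r2 [q2 [-> r2E]]].
  exists (r1 * r2), (q1 * (r2 + 'X_v * q2) + r1 * q2).
  by split; [ring | rewrite subst0M r1E r2E].
have DX i : D 'X_i.
  have [->|iv] := eqVneq i v.
    by exists 0, 1; rewrite mulr1 add0r; split=> //; apply: raddf0.
  by exists 'X_i, 0; rewrite mulr0 addr0 subst0X (negPf iv).
have DC c : D c%:MP by exists c%:MP, 0; rewrite mulr0 addr0 /subst0 comp_mpolyC.
have D1 : D 1 by rewrite -mpolyC1; apply: DC.
elim/mpolyind: p => [|c m p _ _ [r [q [-> rE]]]]; first by rewrite -(mpolyC0 n K); apply: DC.
have [r' [q' [E' r'E]]] : D (c *: 'X_[m]).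
  rewrite -mul_mpolyC; apply: (DM) => //.
  rewrite mpolyXE_id; apply: (big_ind D D1 DM) => i _.
  by elim: (m i) => [|k IHk]; rewrite ?expr0 // exprS; apply: (DM).
exists (r' + r), (q' + q); split; first by rewrite E'; ring.
by rewrite /subst0 rmorphD /= -!/(subst0 v _) r'E rE.
Qed.

Lemma subst0_xS (v : 'I_n) (S : {set 'I_n}) : v \notin S -> subst0 v (xS K S) = xS K S.
Proof.
move=> vS; rewrite /xS /subst0 rmorph_prod; apply: eq_bigr => i iS /=.
by rewrite -/(subst0 v 'X_i) subst0X; case: eqVneq iS => // ->; rewrite (negPf vS).
Qed.

(** Splitting each coefficient as [r + 'X_v * h] turns the relation into ['X_v * (p - \sum h S * xS
    S) = \sum r S * xS S]. Setting the variable of [v] to 0 kills the left side and fixes the right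
    side, so both vanish. *)
Lemma edge_ideal_colon_var (E : pred {set 'I_n}) (v : 'I_n) (p : R) :
  (forall S, E S -> v \notin S) ->
  in_edge_ideal E ('X_v * p) -> in_edge_ideal E p.
Proof.
move=> vE [c cE].
have /fin_all_exists[r /fin_all_exists[h rhE]] S :
    exists r q, c S = r + 'X_v * q /\ subst0 v r = r by apply: subst0_decomp.
exists h; apply/eqP; rewrite -subr_eq0.
have X0 : 'X_v != 0 :> R by rewrite -msize_poly_eq0 msizeX.
have eqr : 'X_v * (p - \sum_(S | E S) h S * xS K S) = \sum_(S | E S) r S * xS K S.
  rewrite mulrBr cE mulr_sumr -sumrB; apply: eq_bigr => S _.
  by have [{1}-> _] := rhE S; ring.
have : subst0 v ('X_v * (p - \sum_(S | E S) h S * xS K S)) = 0.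
  by rewrite subst0M subst0X eqxx mul0r.
suff -> : subst0 v ('X_v * (p - \sum_(S | E S) h S * xS K S))
    = 'X_v * (p - \sum_(S | E S) h S * xS K S).
  by move/eqP; rewrite mulf_eq0 (negPf X0).
rewrite eqr /subst0 rmorph_sum; apply: eq_bigr => S ES /=.
by rewrite -/(subst0 v _) subst0M subst0_xS ?vE //; have [_ ->] := rhE S.
Qed.

Lemma edge_ideal_gen (E : pred {set 'I_n}) (c : R) (S : {set 'I_n}) :
  E S -> in_edge_ideal E (c * xS K S).
Proof.
move=> ES; exists (fun T => if T == S then c else 0).
rewrite (bigD1 S) //= eqxx big1 ?addr0 // => T /andP[_ /negPf->].
by rewrite mul0r.
Qed.

Lemma edge_idealD (E : pred {set 'I_n}) (p q : R) :
  in_edge_ideal E p -> in_edge_ideal E q -> in_edge_ideal E (p + q).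
Proof.
move=> [c ->] [d ->]; exists (fun S => c S + d S); rewrite -big_split.
by apply: eq_bigr => S _; rewrite mulrDl.
Qed.

Lemma edge_ideal_sub (E : pred {set 'I_n}) (I : R -> Prop) (p : R) :
    I 0 -> (forall p q, I p -> I q -> I (p + q)) ->
    (forall S c, E S -> I (c * xS K S)) ->
  in_edge_ideal E p -> I p.
Proof. by move=> I0 ID IE [c ->]; apply: (big_ind I) => // S; apply: IE. Qed.

Lemma edge_ideal0 (E : pred {set 'I_n}) : in_edge_ideal E (0 : R).
Proof. by exists (fun=> 0); rewrite big1 // => S _; rewrite mul0r. Qed.

Lemma xSD1 (v : 'I_n) (S : {set 'I_n}) : v \in S -> xS K S = 'X_v * xS K (S :\ v).
Proof. by move=> vS; rewrite /xS (big_setD1 v). Qed.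

Lemma edge_ideal_linear_resolution_eq (t : nat) (E F : pred {set 'I_n}) :
  E =1 F -> has_linear_resolution t (@in_edge_ideal K n E) ->
  has_linear_resolution t (@in_edge_ideal K n F).
Proof.
move=> EF; apply: has_linear_resolution_iff => p.
by split=> -[c ->]; exists c; apply: eq_bigl.
Qed.

Lemma edge_ideal_linear_resolution0 (t : nat) (E : pred {set 'I_n}) :
  E =1 pred0 -> has_linear_resolution t (@in_edge_ideal K n E).
Proof.
move=> E0; apply: has_linear_resolution_iff (has_linear_resolution0 _ _ t) => p.
by split=> [->|[c ->]]; [apply: edge_ideal0 | rewrite big_pred0].
Qed.

(** Combinatorial form of the mapping cone result: [J] is the link and [I] the deletion of [v]. The
    fourth hypothesis gives the inclusion of ideals, and avoidance of [v] by [I] gives the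
    nonzerodivisor. *)
Lemma edge_ideal_linear_resolution_split (t : nat) (v : 'I_n) (E J I : pred {set 'I_n}) :
    (forall S, J S -> v \notin S) -> (forall S, I S -> v \notin S) ->
    (forall S, E S = if v \in S then J (S :\ v) else I S) ->
    (forall S, I S -> exists2 u, u \in S & J (S :\ u)) ->
    has_linear_resolution t (@in_edge_ideal K n J) ->
    has_linear_resolution t.+1 (@in_edge_ideal K n I) ->
  has_linear_resolution t.+1 (@in_edge_ideal K n E).
Proof.
move=> Jv Iv EJI IJ linJ linI.
have IsubJ (p : R) : in_edge_ideal I p -> in_edge_ideal J p.
  apply: (edge_ideal_sub (I := @in_edge_ideal K n J)) => [|p' q|S c /IJ[u uS JS]]; [exact: edge_ideal0 | exact: edge_idealD |].
  by rewrite (xSD1 uS) mulrA; apply: edge_ideal_gen.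
have := linear_resolution_betti_splitting (x := v) linJ linI IsubJ
  (fun p => edge_ideal_colon_var Iv).
apply: has_linear_resolution_iff => p; split=> [[q [r [Jq Ir ->]]]|].
  apply: edge_idealD.
    apply: (edge_ideal_sub (I := fun q => in_edge_ideal E ('X_v * q)) _ _ _ Jq) => [|p' q'|S c JS].
    - by rewrite mulr0; apply: edge_ideal0.
    - by rewrite mulrDr; apply: edge_idealD.
    have -> : 'X_v * (c * xS K S) = c * xS K (v |: S).
      by rewrite (@xSD1 v (v |: S)) ?setU11 // setU1K ?Jv //; ring.
    by apply: edge_ideal_gen; rewrite EJI setU11 setU1K ?Jv.
  apply: (edge_ideal_sub (I := @in_edge_ideal K n E) _ _ _ Ir) => [|p' q'|S c IS];
    [exact: edge_ideal0 | exact: edge_idealD |].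
  by apply: edge_ideal_gen; rewrite EJI (negPf (Iv S IS)).
apply: (edge_ideal_sub (I := fun p : R => exists q r,
  [/\ in_edge_ideal J q, in_edge_ideal I r & p = 'X_v * q + r])) => [|_ _ [q [r [Jq Ir ->]]] [q' [r' [Jq' Ir' ->]]]|S c].
- by exists 0, 0; split; [exact: edge_ideal0|exact: edge_ideal0|ring].
- by exists (q + q'), (r + r'); split; [exact: edge_idealD|exact: edge_idealD|ring].
rewrite EJI; case: ifP => [vS JS|_ IS].
  exists (c * xS K (S :\ v)), 0; rewrite (xSD1 vS).
  by split; [exact: edge_ideal_gen|exact: edge_ideal0|ring].
exists 0, (c * xS K S).
by split; [exact: edge_ideal0|exact: edge_ideal_gen|ring].
Qed.

(** * The families of ideals in the induction *)

Lemma linear_resolution_not_sub (s : nat) (B W : {set 'I_n}) :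
    (forall W : {set 'I_n}, has_linear_resolution s
       (@in_edge_ideal K n (fun S => (S \subset W) && (#|S| == s)))) ->
  has_linear_resolution s.+1
    (@in_edge_ideal K n (fun S => [&& S \subset W, #|S| == s.+1 & ~~ (S \subset B)])).
Proof.
move=> lin_all; have [k] := ubnP #|W|; elim: k W => // k IHk W; rewrite ltnS => Wk.
have [WB|/subsetPn[a aW aB]] := boolP (W \subset B).
  apply: edge_ideal_linear_resolution0 => S /=.
  by apply/negbTE/and3P => -[SW _]; rewrite (subset_trans SW).
(* A set through [a] is never contained in [B], so the link of [a] consists of all [s]-subsets of
   [W :\ a], which [lin_all] covers. *)
apply: (edge_ideal_linear_resolution_split (v := a) _ _ _ _ (lin_all (W :\ a)) (IHk (W :\ a) _)).
- by move=> S /andP[/subsetP SW _]; apply/negP => /SW; rewrite !inE eqxx.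
- by move=> S /and3P[/subsetP SW _ _]; apply/negP => /SW; rewrite !inE eqxx.
- move=> S; case: ifP => aS.
    have -> : ~~ (S \subset B) by apply/subsetPn; exists a.
    by rewrite andbT (cardsD1 a S) aS eqSS subset_setD1.
  by rewrite subsetD1 aS andbT.
- move=> S /and3P[SW /eqP S_card _].
  have /set0Pn[u uS] : S != set0 by rewrite -card_gt0 S_card.
  exists u => //; rewrite (subset_trans (subD1set _ _) SW) /=.
  by move: S_card; rewrite (cardsD1 u S) uS add1n => -[->].
by apply: leq_trans Wk; rewrite [#|W|](cardsD1 a) aW.
Qed.

(** Discharges the hypothesis of the preceding lemma by induction on [s]: no nonempty set is
    contained in [B = set0]. For [s = 0] the generator is the empty product and the ideal is the
    whole ring. *)
Lemma linear_resolution_subsets (s : nat) (W : {set 'I_n}) :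
  has_linear_resolution s (@in_edge_ideal K n (fun S => (S \subset W) && (#|S| == s))).
Proof.
elim: s W => [|s IHs] W.
  apply: has_linear_resolution_iff (has_linear_resolution1 _ _) => p; split=> // _.
  rewrite -[p]mulr1; have -> : 1 = xS K set0 :> R by rewrite /xS big_set0.
  by apply: edge_ideal_gen; rewrite sub0set cards0.
apply: edge_ideal_linear_resolution_eq (linear_resolution_not_sub set0 W IHs) => S.
by rewrite subset0 -card_gt0; case: eqP => [->|]; rewrite ?andbT ?andbF.
Qed.

(** This turns the link of a simplicial vertex into an ideal of the shape treated by
    [linear_resolution_not_sub]. *)
Lemma is_clique_simplicial (e : rel 'I_n) (W S : {set 'I_n}) (v : 'I_n) :
    ssrbool.symmetric e -> simplicial e W v -> S \subset W -> v \in S ->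
  is_clique e S = (S :\ v \subset [set w | e v w]).
Proof.
move=> e_sym [_ v_simp] /subsetP SW vS; apply/forall_inP/subsetP => [cS w|Sv x xS].
  rewrite !inE => /andP[wv wS].
  by have /forall_inP/(_ w wS)/implyP := cS v vS; apply; rewrite eq_sym.
apply/forall_inP => y yS; apply/implyP => xy.
have nbr z : z \in S -> z != v -> e v z.
  by move=> zS zv; have := Sv z; rewrite !inE zv zS; apply.
have [xv|xv] := eqVneq x v; first by rewrite xv nbr // -xv eq_sym.
have [yv|yv] := eqVneq y v; first by rewrite yv e_sym nbr.
by apply: v_simp; rewrite ?SW ?nbr.
Qed.

(** The set [W] allows induction by deleting a simplicial vertex; writing the degree as [t.+2] puts
    the link ideal in degree [t.+1]. *)
Lemma linear_resolution_non_cliques (e : rel 'I_n) (t : nat) (W : {set 'I_n}) :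
    simple_graph e -> chordal e ->
  has_linear_resolution t.+2
    (@in_edge_ideal K n (fun S => (S \subset W) && compl_CH_edge t.+2 e S)).
Proof.
move=> e_simple e_chordal; have [k] := ubnP #|W|.
elim: k W => // k IHk W; rewrite ltnS => Wk.
have [->|[v0 v0W]] := set_0Vmem W.
  apply: edge_ideal_linear_resolution0 => S /=; rewrite subset0.
  by case: eqP => // ->; rewrite /compl_CH_edge cards0.
have [v v_simp] := chordal_simplicial e_simple e_chordal v0W; have [vW _] := v_simp.
have e_sym := e_simple.2.
apply: (edge_ideal_linear_resolution_split (v := v) _ _ _ _
  (linear_resolution_not_sub [set w | e v w] (W :\ v) (@linear_resolution_subsets t))
  (IHk (W :\ v) _)).
- by move=> S /and3P[/subsetP SW _ _]; apply/negP => /SW; rewrite !inE eqxx.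
- by move=> S /andP[/subsetP SW _]; apply/negP => /SW; rewrite !inE eqxx.
- move=> S; rewrite /compl_CH_edge; case: ifP => vS; last by rewrite subsetD1 vS andbT.
  have [SW|nSW] := boolP (S \subset W); last by rewrite subset_setD1 // (negPf nSW).
  rewrite (cardsD1 v S) vS eqSS subset_setD1 // SW.
  by rewrite (is_clique_simplicial e_sym v_simp).
- move=> S /andP[SW /andP[/eqP S_card S_nclique]].
  (* Neighbours of [v] in [W] form a clique, so a non-clique has a vertex [x] outside them. As [S]
     has at least two elements, some [u] other than [x] can be removed, and [x] keeps [S :\ u] in
     the link. *)
  have [x xS nvx] : exists2 x, x \in S & x \notin [set w | e v w].
    apply/subsetPn; apply: contra S_nclique => /subsetP Sv.
    apply/forall_inP => x xS; apply/forall_inP => y yS; apply/implyP => xy.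
    have inW z : z \in S -> z \in W.
      by move=> zS; have /subsetP/(_ z zS) := SW; rewrite inE => /andP[].
    by have := Sv x xS; have := Sv y yS; rewrite !inE => ? ?; apply: v_simp.2; rewrite ?inW.
  have /set0Pn[u] : S :\ x != set0.
    by rewrite -card_gt0; move: S_card; rewrite (cardsD1 x S) xS add1n => -[->].
  rewrite !inE => /andP[ux uS]; exists u => //.
  rewrite (subset_trans (subD1set _ _) SW) /=; apply/andP; split.
    by move: S_card; rewrite (cardsD1 u S) uS add1n => -[->].
  by apply/subsetPn; exists x => //; rewrite !inE eq_sym ux.
by apply: leq_trans Wk; rewrite [#|W|](cardsD1 v) vW.
Qed.

End EdgeIdeals.

Theorem theorem5p2 (K : fieldType) (n : nat) (e : rel 'I_n) (t : nat) :
  simple_graph e -> chordal e -> (2 <= t)%N ->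
  has_linear_resolution t (@in_edge_ideal K n (compl_CH_edge t e)).
Proof.
case: t => [|[|t]] // e_simple e_chordal _.
apply: edge_ideal_linear_resolution_eq
  (linear_resolution_non_cliques K t setT e_simple e_chordal) => S.
by rewrite subsetT.
Qed.
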